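(* Let $X$ be a (real) Hilbert space, let $A:X\to2^X$ be maximally monotone and let $B:X\to X$ be $\beta$-cocoercive for some $\beta>0$. Let $\gamma\in(0,2\beta)$ and $\delta:=\min\{1,\beta/\gamma\}+1/2$. Let $x_0\in X$, $y\in\mathrm{zer}(A+B)$ and let $b\in\mathbb{N}$ with $\|x_0-y\|\leq b$. Let $\lambda:[0,+\infty)\to[0,\delta]$ be Lebesgue measurable and let $x$ be the unique strong global solution of \[ \dot x(t)=\lambda(t)\left(J_{\gamma A}(x(t)-\gamma B(x(t)))-x(t)\right),\qquad x(0)=x_0. \] Assume either: (1) $\int_0^{+\infty}\lambda(t)(\delta-\lambda(t))\,dt=+\infty$ with a divergence modulus $\eta:(0,\infty)\to\mathbb{N}$, i.e. $\int_0^r\lambda(t)(\delta-\lambda(t))\,dt\geq K$ for all $K>0$ and $r\geq\eta(K)$, where $\eta(K)\geq\eta(L)$ for $K\geq L$; in this case set $\varphi(\varepsilon):=\eta(\delta b^2/\varepsilon^2)$; or (2) $\inf_{t\geq0}\lambda(t)>0$ with a witness $\underline{\lambda}>0$, i.e. $\lambda(t)\geq\underline{\lambda}$ for all $t\geq0$; in this case set $\varphi(\varepsilon):=4b^4\delta^2/(\underline{\lambda}^2\varepsilon^2)$. In either case set $\psi(\varepsilon):=\varphi(\gamma\beta\varepsilon^2/(3b))$. If $A$ or $B$ is uniformly monotone with function $\phi$, then in either case (1) or (2), $x(t)$ converges to $y$ as $t\to\infty$, and \[ \forall\varepsilon>0\ \forall t\geq\rho(\varepsilon)\ (\|x(t)-y\|\leq\varepsilon),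 \] where: (i) if $A$ is uniformly monotone with function $\phi$, then \[ \rho(\varepsilon):=\max\left\{\varphi\left(\min\left\{\frac{\gamma\phi(\varepsilon/2)}{2b},\frac{\varepsilon}{2}\right\}\right),\psi\left(\frac{\phi(\varepsilon/2)}{2b}\right)\right\}; \] (ii) if $B$ is uniformly monotone with function $\phi$, then $\rho(\varepsilon):=\psi(\phi(\varepsilon)/b)$.
   Context: $\mathbb{N}$ denotes the natural numbers. $B$ is $\beta$-cocoercive if $\beta\|Bu-Bv\|^2\leq\langle u-v,Bu-Bv\rangle$ for all $u,v\in X$. $J_{\gamma A}:=(\mathrm{Id}+\gamma A)^{-1}$ is the (single-valued, everywhere defined) resolvent of $\gamma A$, and $\mathrm{zer}(A+B):=\{u\in X\mid0\in Au+Bu\}$. A set-valued operator $M:X\to2^X$ is uniformly monotone with function $\phi$ if $\langle u-v,u'-v'\rangle\geq\phi(\|u-v\|)$ for all $u,v\in X$, $u'\in Mu$, $v'\in Mv$, where $\phi:[0,\infty)\to[0,\infty)$ is an increasing function which vanishes only at $0$. A strong global solution is a function $x:[0,+\infty)\to X$ which is absolutely continuous on each interval $[0,a]$, $a\in(0,\infty)$, satisfies $x(0)=x_0$, and satisfies the differential equation almost everywhere on $[0,+\infty)$; under the stated assumptions it exists and is unique. *)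

(* Defs.v *)
From HB Require Import structures.
From mathcomp Require Import all_boot all_order all_algebra.
From mathcomp Require Import all_classical all_reals all_analysis.

Set Implicit Arguments.
Unset Strict Implicit.
Unset Printing Implicit Defensive.

Import Order.TTheory GRing.Theory Num.Theory.
Import numFieldNormedType.Exports.

Local Open Scope classical_set_scope.
Local Open Scope ring_scope.

(* A real Hilbert space is a [completeNormedModType R] together with an inner
   product [dot : {dot X for idfun}] (symmetric, bilinear, positive definite)
   that induces its norm. *)
Definition norm_of_dot (R : realType) (X : completeNormedModType R)
    (dot : {dot X for idfun}) : Prop :=
  forall u : X, `|u| ^+ 2 = dot u u.

Section set_valued_operators.
Context {R : realType} {X : completeNormedModType R}.
Implicit Types (M N : X -> set X) (f : X -> X) (dot : X -> X -> R).

Definition sv_of f : X -> set X := fun u => [set f u].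

Definition sv_add M N : X -> set X :=
  fun u => [set v + w | v in M u & w in N u].

Definition sv_scale (c : R) M : X -> set X :=
  fun u => [set c *: v | v in M u].

Definition sv_inv M : X -> set X := fun v => [set u | M u v].

Definition zer M : set X := [set u | M u 0].

(* [Id + gamma A] is onto with a single-valued inverse when [A] is maximally
   monotone and [gamma > 0] (Minty), so that [xget] selects the unique value
   and the default [0] plays no role. *)
Definition resolvent (gamma : R) M : X -> X :=
  fun u => xget 0 (sv_inv (sv_add (sv_of idfun) (sv_scale gamma M)) u).

Definition monotone_op dot M : Prop :=
  forall u v u' v', M u u' -> M v v' -> 0 <= dot (u - v) (u' - v').

Definition maximally_monotone dot M : Prop :=
  monotone_op dot M /\
  forall N, monotone_op dot N -> (forall u, M u `<=` N u) -> N = M.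

Definition cocoercive dot (beta : R) f : Prop :=
  forall u v, beta * `|f u - f v| ^+ 2 <= dot (u - v) (f u - f v).

Definition uniformly_monotone dot (phi : R -> R) M : Prop :=
  forall u v u' v', M u u' -> M v v' ->
    phi `|u - v| <= dot (u - v) (u' - v').

End set_valued_operators.

(* For [phi : [0, +oo) -> [0, +oo)]; only the values on the half-line matter,
   and "increasing" is not required to be strict. *)
Definition monotonicity_modulus (R : realType) (phi : R -> R) : Prop :=
  [/\ forall r, 0 <= r -> 0 <= phi r,
      forall r s, 0 <= r -> r <= s -> phi r <= phi s
    & forall r, 0 <= r -> (phi r = 0 <-> r = 0)].

(* The real line with its Lebesgue (not just Borel) sigma-algebra, i.e. the
   domain of [completed_lebesgue_measure]. *)
Definition lebesgueR (R : realType) : measurableType _ :=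
  caratheodory_type ((wlength (@idfun R))^*)%mu.

Definition lebesgue_measurable_fun (R : realType) (D : set R) (f : R -> R) :
    Prop :=
  measurable_fun (D : set (lebesgueR R)) (f : lebesgueR R -> R).

Definition absolutely_continuous (R : realType) (X : normedModType R)
    (a b : R) (f : R -> X) : Prop :=
  forall eps : R, 0 < eps -> exists2 d : R, 0 < d &
    forall (n : nat) (u v : 'I_n -> R),
      (forall i, [/\ a <= u i, u i <= v i & v i <= b]) ->
      trivIset setT (fun i => [set` `]u i, v i[]) ->
      \sum_(i < n) (v i - u i) < d ->
      \sum_(i < n) `|f (v i) - f (u i)| < eps.

(* [x : R -> X] is only meaningful on [0, +oo). *)
Definition strong_global_solution (R : realType) (X : completeNormedModType R)
    (A : X -> set X) (B : X -> X) (gamma : R) (lambda : R -> R) (x0 : X)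
    (x : R -> X) : Prop :=
  [/\ forall a, 0 < a -> absolutely_continuous 0 a x,
      x 0 = x0
    & {ae (@completed_lebesgue_measure R), forall t : R, 0 <= t ->
        is_derive t 1 x
          (lambda t *: (resolvent gamma A (x t - gamma *: B (x t)) - x t))}].

Definition divergence_modulus (R : realType) (f : R -> R) (eta : R -> nat) :
    Prop :=
  (forall K r : R, 0 < K -> (eta K)%:R <= r ->
     (K%:E <= \int[@completed_lebesgue_measure R]_(t in `[0%R, r]) (f t)%:E)%E) /\
  (forall K L : R, 0 < L -> L <= K -> (eta L <= eta K)%N).

Definition converges_with_rate (R : realType) (X : normedModType R)
    (x : R -> X) (y : X) (rho : R -> R) : Prop :=
  (x t @[t --> +oo] --> y) /\
  (forall eps : R, 0 < eps -> forall t : R, rho eps <= t -> `|x t - y| <= eps).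

(* Main.v *)
Require Import Defs.
From HB Require Import structures.
From mathcomp Require Import all_boot all_order all_algebra.
From mathcomp Require Import all_classical all_reals all_analysis.
From mathcomp Require Import measurable_realfun ring lra.

Set Implicit Arguments.
Unset Strict Implicit.
Unset Printing Implicit Defensive.

Import Order.TTheory GRing.Theory Num.Theory.
Import numFieldNormedType.Exports.

Local Open Scope classical_set_scope.
Local Open Scope ring_scope.

(** Write T u for the forward-backward map J_(gamma A) (u - gamma B u) and
    r u = T u - u for its residual, so that the equation reads
    x' = lambda(t) r(x) and y is a zero of r.

    Geometry of the residual. Minty's theorem makes T everywhere defined, and
    monotonicity of A together with cocoercivity of B shows that - r is
    (delta / 2)-cocoercive ([fb_residual_cocoercive]). Two consequences drive
    the dynamics. An explicit Euler step u + s r(u), 0 <= s <= 1, increases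
    neither |u - y| nor |r u|, and a backward step u - s r(u) decreases
    neither; since x is absolutely continuous, both |x(t) - y| and |r(x(t))|
    are therefore nonincreasing. Moreover
    d/dt |x - y|^2 = 2 lambda <x - y, r x> <= - lambda delta |r x|^2, and
    integrating this bound on [0, T] with |r(x(t))| >= |r(x(T))| gives
    |r(x(T))|^2 times the integral of g <= b^2 for every measurable g with
    0 <= g <= delta lambda ([residual_integral_le]). The choices
    g = lambda (delta - lambda) and g = the lower bound of lambda show that
    |r(x(t))| < eps once t >= varphi(eps), in cases (1) and (2).

    From the residual to the distance. Testing the monotonicity of A at T u
    and y gives gamma <u - y, B u - B y> <= 3 b |r u|, hence
    |B x(t) - B y| < eps once t >= psi(eps). If A is uniformly monotone, then
    phi(|T x - y|) <= b (|r x| / gamma + |B x - B y|), and if B is, then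
    phi(|x - y|) <= b |B x - B y|; the two rates are chosen so that the right
    sides are smaller than phi(eps / 2), respectively phi(eps). As phi is only
    nondecreasing, all these inequalities are kept strict, which is possible
    because delta > 1: phi(s) < phi(eps) forces s < eps, whereas
    phi(s) <= phi(eps) says nothing when phi is constant between eps and s.

    Minty's theorem is proved by maximizing a concave quadratic function over
    a convex hull, where the parallelogram identity replaces weak compactness.
    The monotonicity of absolutely continuous functions follows from a
    continuous induction that hides the exceptional null set in an open set of
    small measure, and the integral bound from Fatou's lemma applied to
    difference quotients over uniform partitions. *)

(** * Inner products *)

Section inner_product.
Context {R : realType} {X : completeNormedModType R} (dot : {dot X for idfun}).
Hypothesis hdot : norm_of_dot dot.

Lemma dotC u v : dot u v = dot v u.
Proof. by rewrite hermC /= expr0 mul1r. Qed.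

Lemma dotDl u v w : dot (u + v) w = dot u w + dot v w.
Proof. exact: linearDl. Qed.
Lemma dotDr u v w : dot w (u + v) = dot w u + dot w v.
Proof. exact: linearDr. Qed.
Lemma dotNl u w : dot (- u) w = - dot u w.
Proof. exact: linearNl. Qed.
Lemma dotNr u w : dot w (- u) = - dot w u.
Proof. exact: linearNr. Qed.
Lemma dotZl c u w : dot (c *: u) w = c * dot u w.
Proof. exact: linearZl_LR. Qed.
Lemma dotZr c u w : dot w (c *: u) = c * dot w u.
Proof. by rewrite dotC dotZl dotC. Qed.

Definition dotE := (dotDl, dotDr, dotNl, dotNr, dotZl, dotZr).

(** Reduces an identity between linear combinations of vectors to an identity
    between linear combinations of scalars, which [ring] or [field] decides. *)
Lemma dot_ext u v : (forall w, dot u w = dot v w) -> u = v.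
Proof.
move=> uv; apply/eqP; rewrite -subr_eq0 -normr_eq0 -sqrf_eq0 hdot.
by rewrite dotDl dotNl uv subrr.
Qed.

(** Cauchy-Schwarz, from 0 <= | |v| u - |u| v |^2. *)
Lemma dot_le_norm u v : dot u v <= `|u| * `|v|.
Proof.
have [->|v0] := eqVneq v 0; first by rewrite linear0r normr0 mulr0.
have v_gt0 : 0 < `|v| by rewrite normr_gt0.
have := sqr_ge0 `| `|v| *: u - `|u| *: v |.
rewrite hdot !dotE -(hdot u) -(hdot v) (dotC v u) => H.
have [->|u0] := eqVneq u 0; first by rewrite linear0l normr0 mul0r.
have u_gt0 : 0 < `|u| by rewrite normr_gt0.
have : 0 <= 2 * (`|u| * `|v|) * (`|u| * `|v| - dot u v) by lra.
by rewrite pmulr_rge0 ?subr_ge0// !mulr_gt0.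
Qed.

(** * Minty's theorem *)

(** The convex hull of the triples (a, w, <a, w>), (a, w) in G. As <., .> is
    not affine, the third component of a combination is in general not the
    product of the first two. *)
Inductive dot_hull (G : set (X * X)) : X -> X -> R -> Prop :=
| dot_hull_gen a w : G (a, w) -> dot_hull G a w (dot a w)
| dot_hull_conv s a w k a' w' k' : 0 <= s <= 1 ->
    dot_hull G a w k -> dot_hull G a' w' k' ->
    dot_hull G ((1 - s) *: a + s *: a') ((1 - s) *: w + s *: w')
      ((1 - s) * k + s * k').

(** The Lagrangian dual function of the problem of finding p with
    <p - a, p - w> <= 0 for all (a, w) in G: for the convex combination with
    data (a, w, k) it is the minimum over p of |p|^2 - <p, a + w> + k, reached
    at p = (a + w) / 2. *)
Definition dual_value (a w : X) (k : R) := k - `|2^-1 *: (a + w)| ^+ 2.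

(** For generators this is the hypothesis on G, and both sides are affine in
    each of the two triples. *)
Lemma dot_hull_cross G : 
  (forall a w a' w', G (a, w) -> G (a', w') -> dot (a - a') (w - w') <= 0) ->
  forall a w k a' w' k', dot_hull G a w k -> dot_hull G a' w' k' ->
  k + k' <= dot a w' + dot a' w.
Proof.
move=> hG a w k a' w' k'.
elim=> {a w k} [a w Gaw|s a w k a2 w2 k2 /andP[s0 s1] _ IH1 _ IH2] H'.
- elim: H' => {a' w' k'} [a' w' Gaw'|s a' w' k' a2 w2 k2 /andP[s0 s1] _ IH1 _ IH2].
    by have := hG _ _ _ _ Gaw Gaw'; rewrite !dotE; lra.
  rewrite !dotE.
  have t0 : 0 <= 1 - s by rewrite subr_ge0.
  have := lerD (ler_wpM2l t0 IH1) (ler_wpM2l s0 IH2); lra.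
- move: (IH1 H') (IH2 H') => {}IH1 {}IH2; rewrite !dotE.
  have t0 : 0 <= 1 - s by rewrite subr_ge0.
  have := lerD (ler_wpM2l t0 IH1) (ler_wpM2l s0 IH2); lra.
Qed.

(** The cross inequality of a triple with itself gives k <= <a, w>. *)
Lemma dual_value_le0 G :
  (forall a w a' w', G (a, w) -> G (a', w') -> dot (a - a') (w - w') <= 0) ->
  forall a w k, dot_hull G a w k -> dual_value a w k <= 0.
Proof.
move=> hG a w k H; have := dot_hull_cross hG H H.
have := sqr_ge0 `|a - w|; rewrite /dual_value !hdot !dotE (dotC w a).
lra.
Qed.

Lemma dual_value_conv (s : R) a w (k : R) a' w' (k' : R) :
  dual_value ((1 - s) *: a + s *: a') ((1 - s) *: w + s *: w')
      ((1 - s) * k + s * k') =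
  (1 - s) * dual_value a w k + s * dual_value a' w' k'
  + s * (1 - s) * `|2^-1 *: (a + w) - 2^-1 *: (a' + w')| ^+ 2.
Proof.
rewrite /dual_value !hdot !dotE (dotC w a) (dotC a' a) (dotC a' w) (dotC w' a)
  (dotC w' w) (dotC w' a').
by field.
Qed.

(** The balls with diameters [a, w] have a common point. Along a sequence of
    convex combinations whose dual values tend to their supremum, the centers
    (a + w) / 2 form a Cauchy sequence, because by [dual_value_conv] the
    midpoint of two of them gains a quarter of their squared distance. Moving
    from such a combination towards a generator cannot exceed the supremum
    either, and to first order this says that the limit p lies in the ball of
    that generator. No compactness is involved, so G may be infinite. *)
Lemma antimonotone_common_point G : G !=set0 ->
  (forall a w a' w', G (a, w) -> G (a', w') -> dot (a - a') (w - w') <= 0) ->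
  exists p, forall a w, G (a, w) -> dot (p - a) (p - w) <= 0.
Proof.
move=> [[a0 w0] G0] hG.
pose V := [set d | exists a w k, dot_hull G a w k /\ d = dual_value a w k].
have V0 : V !=set0.
  by exists (dual_value a0 w0 (dot a0 w0)), a0, w0, (dot a0 w0); split => //; constructor.
have Vub : ubound V 0.
  by move=> d [a [w [k [H ->]]]]; exact: dual_value_le0 hG _ _ _ H.
have supV : has_sup V by split => //; exists 0.
have S0 : sup V <= 0 by apply: ge_sup.
have leS a w k : dot_hull G a w k -> dual_value a w k <= sup V.
  by move=> H; apply: ub_le_sup; [exists 0|exists a, w, k].
have /choice[m hm] : forall n, exists p : X * X * R,
   dot_hull G p.1.1 p.1.2 p.2 /\
     sup V - n.+1%:R^-1 < dual_value p.1.1 p.1.2 p.2.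
  move=> n; have [|d [a [w [k [H ->]]]] lt] := @sup_adherent _ V n.+1%:R^-1 _ supV.
    by rewrite invr_gt0.
  by exists (a, w, k).
pose c n := 2^-1 *: ((m n).1.1 + (m n).1.2).
have cc i j : `|c i - c j| ^+ 2 <= 2 * (i.+1%:R^-1 + j.+1%:R^-1).
  have [Hi lti] := hm i; have [Hj ltj] := hm j.
  have h01 : 0 <= (2^-1 : R) <= 1 by lra.
  have := leS _ _ _ (dot_hull_conv h01 Hi Hj).
  rewrite dual_value_conv -/(c i) -/(c j).
  move: lti ltj; move: (i.+1%:R^-1) (j.+1%:R^-1) => ei ej; lra.

have cvgc : cvg (c @ \oo).
  apply/cauchy_cvgP/cauchy_exP => e e0.
  have e4 : 0 < e ^+ 2 / 4 by rewrite divr_gt0// exprn_gt0.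
  have [N _ HN] := near_infty_natSinv_lt (PosNum e4).
  exists (c N); exists N => // n /= Nn.
  rewrite -ball_normE /ball_ /= -(@ltr_pXn2r _ 2)// ?nnegrE// ?(ltW e0)//.
  apply: le_lt_trans (cc N n) _.
  have := HN N (leqnn N); have := HN n Nn; rewrite /=.
  move: (N.+1%:R^-1) (n.+1%:R^-1) => ei ej; lra.
exists (lim (c @ \oo)) => a w Gaw; set p := lim _.
pose g := 2^-1 *: (a + w); pose d := dual_value a w (dot a w).
have cg : (fun n => `|c n - g| ^+ 2) @ \oo --> `|p - g| ^+ 2.
  have -> : (fun n => `|c n - g| ^+ 2) = (fun n => `|c n - g| * `|c n - g|).
    by apply/funext => n; rewrite expr2.
  have h : (fun n => `|c n - g|) @ \oo --> `|p - g|.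
    by apply: cvg_norm; apply: cvgB => //; exact: cvg_cst.
  by rewrite expr2; exact: cvgM.
(* Moving a fraction s of the way towards the generator (a, w). *)
have step s : 0 < s < 1 -> (1 - s) * `|p - g| ^+ 2 <= - d.
  move=> /andP[s0 s1].
  suff : s * (1 - s) * `|p - g| ^+ 2 <= - (s * d).
    by rewrite -mulrN -mulrA ler_pM2l.
  apply: (@ler_cvg_to _ (nbhs \oo) _ _ (fun n => s * (1 - s) * `|c n - g| ^+ 2)
    (fun n => - (s * d) + n.+1%:R^-1)).
  - by apply: cvgM; [exact: cvg_cst|exact: cg].
  - rewrite -[X in _ --> X]addr0; apply: cvgD; first exact: cvg_cst.
    exact: cvg_harmonic.
  - apply: nearW => n; have [Hn ltn] := hm n.
    have h01 : 0 <= s <= 1 by rewrite !ltW.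
    have := leS _ _ _ (dot_hull_conv h01 Hn (dot_hull_gen Gaw)).
    rewrite dual_value_conv -/(c n) -/g -/d => le.
    have : (1 - s) * (sup V - n.+1%:R^-1) <= (1 - s) * dual_value (m n).1.1 (m n).1.2 (m n).2.
      by rewrite ler_pM2l ?subr_gt0// ltW.
    have : 0 <= s * n.+1%:R^-1 by rewrite mulr_ge0 ?invr_ge0// ltW.
    have : 0 <= s * - sup V by rewrite mulr_ge0 ?oppr_ge0// ltW.
    move: le; move: (n.+1%:R^-1) => en; lra.
have pg : `|p - g| ^+ 2 <= - d.
  rewrite leNgt; apply/negP => lt.
  have d0 : 0 <= - d by rewrite oppr_ge0; apply: (dual_value_le0 hG) (dot_hull_gen Gaw).
  move: (`|p - g| ^+ 2) d step lt d0 => Q {}d step lt d0.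
  have Q0 : 0 < Q by exact: le_lt_trans d0 lt.
  (* This s halves the gap: (1 - s) Q is the mean of Q and - d, above - d. *)
  have := step ((Q + d) / (2 * Q)).
  rewrite divr_gt0/= ?mulr_gt0//; last by rewrite addrC -ltrBlDl sub0r.
  rewrite ltr_pdivrMr ?mulr_gt0// => /(_ _)/wrap[]; first by lra.
  have -> : (1 - (Q + d) / (2 * Q)) * Q = (Q - d) / 2 by field; rewrite gt_eqF.
  lra.
move: pg; rewrite /d /dual_value -/g !hdot /g !dotE (dotC w a) (dotC a p) (dotC w p).
lra.
Qed.
End inner_product.

Section forward_backward.
Context {R : realType} {X : completeNormedModType R} (dot : {dot X for idfun}).
Hypothesis hdot : norm_of_dot dot.

(** With w = u - gamma a', the inequality <p - a, p - w> <= 0 for all (a, a')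
    in the graph of A says that (u - p) / gamma can be added to A p without
    losing monotonicity; by maximality it is there already. *)
Lemma minty (A : X -> set X) (gamma : R) : maximally_monotone dot A ->
  (exists y v, A y v) -> 0 < gamma ->
  forall u, exists p, A p (gamma^-1 *: (u - p)).
Proof.
move=> [monA maxA] [y [v Ayv]] g0 u.
pose G := [set aw : X * X | exists2 a', A aw.1 a' & aw.2 = u - gamma *: a'].
have [||p hp] := @antimonotone_common_point _ _ dot hdot G.
- by exists (y, u - gamma *: v), v.
- move=> a w a2 w2 [a' /= Aa ->] [a2' /= Aa2 ->].
  have := monA _ _ _ _ Aa Aa2.
  have -> : u - gamma *: a' - (u - gamma *: a2') = - (gamma *: (a' - a2')).
    by apply: (dot_ext hdot) => b; rewrite !(dotE dot); ring.
  by rewrite (dotNr dot) (dotZr dot) oppr_le0 (pmulr_rge0 _ g0).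
have key a a' : A a a' -> 0 <= dot (p - a) (gamma^-1 *: (u - p) - a').
  move=> Aa; have /hp : G (a, u - gamma *: a') by exists a'.
  have -> : p - (u - gamma *: a') = - (gamma *: (gamma^-1 *: (u - p) - a')).
    by apply: (dot_ext hdot) => b; rewrite !(dotE dot); field; rewrite gt_eqF.
  by rewrite (dotNr dot) (dotZr dot) oppr_le0 (pmulr_rge0 _ g0).
exists p; pose N w := A w `|` [set a' | w = p /\ a' = gamma^-1 *: (u - p)].
suff <- : N = A by right.
apply: maxA => [w1 w2 w1' w2'|w a']; last by left.
move=> [A1|[-> ->]] [A2|[-> ->]].
- exact: monA.
- have := key _ _ A1.
  by rewrite -opprB (dotNl dot) -[X in dot _ X]opprB (dotNr dot) opprK.
- exact: key.
- by rewrite subrr linear0l.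
Qed.

Variables (A : X -> set X) (B : X -> X) (beta gamma : R).
Hypotheses (hA : maximally_monotone dot A) (hB : cocoercive dot beta B).
Hypotheses (hbeta : 0 < beta) (hgamma : 0 < gamma < 2 * beta).
Variable y : X.
Hypothesis hy : zer (sv_add A (sv_of B)) y.

(** * The forward-backward map and its residual *)

Definition fb_map u := resolvent gamma A (u - gamma *: B u).
Definition fb_residual u := fb_map u - u.

Let gamma_gt0 : 0 < gamma. Proof. by case/andP: hgamma. Qed.

Lemma zer_opp : A y (- B y).
Proof. by case: hy => v Av [w -> /eqP]; rewrite addr_eq0 => /eqP <-. Qed.

Lemma resolventP u : A (resolvent gamma A u) (gamma^-1 *: (u - resolvent gamma A u)).
Proof.
rewrite /resolvent; set S := sv_inv _ _.
have [p Ap] := minty hA (ex_intro _ _ (ex_intro _ _ zer_opp)) gamma_gt0 u.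
have [_ -> [_ [a' Aa' <-]] <-] : S (xget 0 S).
  apply: (@xgetPex _ (0 : X)); exists p; rewrite /S /sv_inv /=.
  exists p => //; exists (u - p); last by rewrite addrC subrK.
  by exists (gamma^-1 *: (u - p)) => //; rewrite scalerA divff ?gt_eqF// scale1r.
by rewrite /= addrAC subrr add0r scalerA mulVf ?gt_eqF// scale1r.
Qed.

Lemma fb_mapP u : A (fb_map u) (- (gamma^-1 *: fb_residual u) - B u).
Proof.
have := resolventP (u - gamma *: B u); rewrite -/(fb_map u).
congr (A _ _); rewrite addrAC scalerBr scalerA mulVf ?gt_eqF// scale1r.
by rewrite /fb_residual -scalerN opprB.
Qed.

Lemma fb_map_zer : fb_map y = y.
Proof.
have := hA.1 _ _ _ _ (fb_mapP y) zer_opp.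
rewrite opprK addrNK -/(fb_residual y) (dotNr dot) (dotZr dot) oppr_ge0.
rewrite -hdot pmulr_rle0 ?invr_gt0// => le0.
apply/eqP; rewrite -subr_eq0 -normr_eq0 -sqrf_eq0 eq_le le0.
exact: sqr_ge0.
Qed.

Lemma fb_residual_zer : fb_residual y = 0.
Proof. by rewrite /fb_residual fb_map_zer subrr. Qed.

Variable delta : R.
Hypothesis hdelta : delta = Num.min 1 (beta / gamma) + 1 / 2.

Lemma delta_gt1 : 1 < delta.
Proof.
rewrite hdelta; have [g0 g1] := andP hgamma.
have : 2^-1 < beta / gamma by rewrite ltr_pdivlMr//; lra.
by move: (beta / gamma) => t; case: (leP 1 t) => ?; lra.
Qed.

(** With g = gamma / beta in (0, 2), the difference of the two sides is
    (1 - g) / 4 when g <= 1 and (g - 1) (2 - g) / (4 g) when g >= 1. *)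
Lemma delta_le : delta / 2 <= 1 - gamma / (4 * beta).
Proof.
have [h0 h1] := andP hgamma.
pose g := gamma / beta.
have g0 : 0 < g by rewrite divr_gt0.
have g2 : g < 2 by rewrite ltr_pdivrMr.
have -> : gamma / (4 * beta) = g / 4 by rewrite /g; field; rewrite gt_eqF.
have -> : delta = Num.min 1 (g^-1) + 1 / 2 by rewrite hdelta /g invf_div.
clearbody g.
have [le1|gt1] := leP 1 (g^-1).
  have : g <= 1 by rewrite -(@ler_pV2 _) ?invr1// inE/= ?unitfE ?gt_eqF ?ltr01.
  lra.
have g1 : 1 < g by rewrite -(@ltr_pV2 _) ?invr1// inE/= ?unitfE ?gt_eqF ?ltr01.
rewrite -subr_ge0.
have -> : 1 - g / 4 - (g^-1 + 1 / 2) / 2 = (g - 1) * (2 - g) / (4 * g).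
  by field; rewrite gt_eqF.
by rewrite divr_ge0// ?mulr_ge0//; lra.
Qed.

(** Write q, r, e for the differences of u, of the residuals and of B.
    Monotonicity of A at the two images gives
    - <q, r> >= |r|^2 + gamma <q, e> + gamma <r, e>; bounding <q, e> below by
    beta |e|^2 and minimizing over e leaves
    - <q, r> >= (1 - gamma / (4 beta)) |r|^2. *)
Lemma fb_residual_cocoercive u v :
  delta / 2 * `|fb_residual u - fb_residual v| ^+ 2 <=
  - dot (u - v) (fb_residual u - fb_residual v).
Proof.
have [h0 h1] := andP hgamma.
set q := u - v; set r := _ - _; set e := B u - B v.
have mon : 0 <= dot (q + r) (- (gamma^-1 *: r) - e).
  have := hA.1 _ _ _ _ (fb_mapP u) (fb_mapP v).
  have -> : fb_map u - fb_map v = q + r.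
    by apply: (dot_ext hdot) => w; rewrite /q /r /fb_residual !(dotE dot); ring.
  congr (0 <= dot _ _); rewrite /r /e.
  by apply: (dot_ext hdot) => w; rewrite !(dotE dot); ring.
have Bq : gamma * (beta * `|e| ^+ 2) <= gamma * dot q e by rewrite ler_pM2l//; exact: hB.
clearbody q r e.
have : 0 <= gamma * dot (q + r) (- (gamma^-1 *: r) - e) by rewrite mulr_ge0// ltW.
have -> : gamma * dot (q + r) (- (gamma^-1 *: r) - e) = 
   - dot q r - `|r| ^+ 2 - gamma * dot q e - gamma * dot r e.
  by rewrite hdot !(dotE dot); field; rewrite gt_eqF.
have : 0 <= gamma / (4 * beta) * `|(2 * beta) *: e + r| ^+ 2.
  by rewrite mulr_ge0 ?sqr_ge0// divr_ge0 ?mulr_ge0// ltW.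
have -> : gamma / (4 * beta) * `|(2 * beta) *: e + r| ^+ 2 =
   gamma * (beta * `|e| ^+ 2) + gamma * dot r e + gamma / (4 * beta) * `|r| ^+ 2.
  by rewrite !hdot !(dotE dot) (dotC dot e r); field; rewrite gt_eqF.
have := ler_wpM2r (sqr_ge0 `|r|) delta_le.
move: Bq; rewrite mulrBl mul1r.
move: (gamma / (4 * beta) * _) => a.
move: (gamma * dot r e) => b; move: (gamma * (beta * _)) => c.
move: (gamma * dot q e) => d; lra.
Qed.


Lemma fb_residual_lip u v :
  `|fb_residual u - fb_residual v| <= 2 * `|u - v|.
Proof.
have := fb_residual_cocoercive u v; have := delta_gt1.
set r := _ - _; set q := u - v => d1 le1.
have := dot_le_norm hdot q (- r); rewrite (dotNr dot) normrN => le2.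
have [r0|r0] := eqVneq `|r| 0; first by rewrite r0 mulr_ge0.
have rp : 0 < `|r| by rewrite lt_def r0/=.
have le3 : 1 / 2 * `|r| ^+ 2 <= delta / 2 * `|r| ^+ 2.
  by rewrite ler_wpM2r ?sqr_ge0//; lra.
suff : `|r| * `|r| <= 2 * `|q| * `|r| by rewrite ler_pM2r.
by rewrite -expr2; lra.
Qed.

(** For w = u + s r(u) and e = r(w) - r(u), cocoercivity yields
    s <r u, e> <= - (delta / 2) |e|^2, so the cross term in
    |r u + e|^2 absorbs |e|^2 as long as s <= delta. *)
Lemma fb_residual_forward s u : 0 <= s <= 1 ->
  `|fb_residual (u + s *: fb_residual u)| <= `|fb_residual u|.
Proof.
move=> /andP[s0 s1]; have [->|sn0] := eqVneq s 0; first by rewrite scale0r addr0.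
have sp : 0 < s by rewrite lt_def sn0.
set w := _ + _; have := fb_residual_cocoercive w u.
have -> : w - u = s *: fb_residual u by rewrite /w addrAC subrr add0r.
have ewu : fb_residual w = fb_residual u + (fb_residual w - fb_residual u).
  by rewrite addrC subrK.
move: (_ - _) ewu => e ->.
move: (fb_residual u) => r; rewrite (dotZl dot) => le1.
rewrite -(@ler_pXn2r _ 2)// ?nnegrE//.
rewrite [X in X <= _]hdot !(dotE dot) -!hdot (dotC dot e) -subr_le0 -(pmulr_rle0 _ sp).
have := ler_wpM2r (sqr_ge0 `|e|) (le_trans s1 (ltW delta_gt1)).
lra.
Qed.

(** For w = u - s r(u), cocoercivity gives <r u, r w - r u> >= 0. *)
Lemma fb_residual_backward s u : 0 <= s ->
  `|fb_residual u| <= `|fb_residual (u - s *: fb_residual u)|.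
Proof.
move=> s0; have [->|sn0] := eqVneq s 0; first by rewrite scale0r subr0.
have sp : 0 < s by rewrite lt_def sn0.
set w := _ - _; have := fb_residual_cocoercive w u.
have -> : w - u = - (s *: fb_residual u) by rewrite /w addrAC subrr add0r.
have ewu : fb_residual w = fb_residual u + (fb_residual w - fb_residual u).
  by rewrite addrC subrK.
move: (_ - _) ewu => e ->.
move: (fb_residual u) => r; rewrite (dotNl dot) (dotZl dot) opprK => le1.
rewrite -(@ler_pXn2r _ 2)// ?nnegrE//.
rewrite [X in _ <= X]hdot !(dotE dot) -!hdot (dotC dot e).
have : 0 <= dot r e.
  rewrite -(pmulr_rge0 _ sp); apply: le_trans le1.
  by rewrite mulr_ge0 ?sqr_ge0// divr_ge0// (le_trans _ (ltW delta_gt1)).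
have := sqr_ge0 `|e|; lra.
Qed.

Lemma fb_residual_dot u :
  dot (u - y) (fb_residual u) <= - (delta / 2 * `|fb_residual u| ^+ 2).
Proof.
by have := fb_residual_cocoercive u y; rewrite fb_residual_zer subr0 lerNr.
Qed.

Lemma fb_map_le u : `|fb_map u - y| <= `|u - y|.
Proof.
rewrite -(@ler_pXn2r _ 2)// ?nnegrE//.
have -> : fb_map u - y = (u - y) + fb_residual u.
  by apply: (dot_ext hdot) => w; rewrite /fb_residual !(dotE dot); ring.
have := fb_residual_dot u.
have := ler_wpM2r (sqr_ge0 `|fb_residual u|) (ltW delta_gt1).
move: (u - y) (fb_residual u) => q r.
rewrite [X in _ -> _ -> X <= _]hdot !(dotE dot) -!hdot (dotC dot r).
lra.
Qed.

Lemma fb_map_monotone_zer u :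
  gamma * dot (fb_map u - y) (B u - B y) <= - dot (fb_map u - y) (fb_residual u).
Proof.
have := hA.1 _ _ _ _ (fb_mapP u) zer_opp.
rewrite -(pmulr_rge0 _ gamma_gt0) => le0; rewrite -subr_ge0.
move: le0; move: (fb_map u - y) (fb_residual u) (B u) (B y) => p r d e.
rewrite !(dotE dot); congr (0 <= _).
by field; rewrite gt_eqF.
Qed.

Lemma cocoercive_lip u : beta * `|B u - B y| <= `|u - y|.
Proof.
have := le_trans (hB u y) (dot_le_norm hdot _ _).
have [->|n0] := eqVneq (B u - B y) 0; first by rewrite normr0 !mulr0.
have np : 0 < `|B u - B y| by rewrite normr_gt0.
by rewrite expr2 mulrA (ler_pM2r np).
Qed.

(** With p = T u - y and d = B u - B y, [fb_map_monotone_zer] and u - y = p - r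
    give gamma <u - y, d> <= - <p, r> - gamma <r, d>. Here |p| <= b since T does
    not increase the distance to y, and gamma |d| <= 2 b since B is
    1 / beta-Lipschitz and gamma < 2 beta. *)
Lemma fb_dotB_le b u : `|u - y| <= b ->
  gamma * dot (u - y) (B u - B y) <= 3 * b * `|fb_residual u|.
Proof.
move=> ub; have := fb_map_monotone_zer u.
have -> : u - y = (fb_map u - y) - fb_residual u.
  by apply: (dot_ext hdot) => w; rewrite /fb_residual !(dotE dot); ring.
have pb : `|fb_map u - y| <= b := le_trans (fb_map_le u) ub.
have b0 : 0 <= b := le_trans (normr_ge0 _) pb.
have db : gamma * `|B u - B y| <= 2 * b.
  have := ler_wpM2l (ltW gamma_gt0) (le_trans (cocoercive_lip u) ub).
  have [_ /ltW g2] := andP hgamma.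
  have := ler_wpM2r b0 g2; move=> h1 h2.
  by rewrite -(ler_pM2l hbeta); lra.
move: pb db; move: (fb_map u - y) (fb_residual u) (B u - B y) => p r d pb db.
rewrite (dotDl dot) (dotNl dot) mulrDr mulrN => le1.
have := dot_le_norm hdot p (- r); rewrite (dotNr dot) normrN => le2.
have := dot_le_norm hdot r (- d); rewrite (dotNr dot) normrN => le3.
have := ler_wpM2r (normr_ge0 r) pb.
have := ler_wpM2r (normr_ge0 r) db.
have := ler_wpM2l (ltW gamma_gt0) le3.
lra.
Qed.

Lemma fb_monotoneA_le b phi u : `|u - y| <= b -> uniformly_monotone dot phi A ->
  gamma * phi `|fb_map u - y| <= b * (`|fb_residual u| + gamma * `|B u - B y|).
Proof.
move=> ub hphi; have := hphi _ _ _ _ (fb_mapP u) zer_opp.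
rewrite -(ler_pM2l gamma_gt0) => /le_trans; apply.
rewrite -(dotZr dot) -!scalerN.
set p := _ - y; set z := gamma *: _.
apply: le_trans (dot_le_norm hdot p z) _.
apply: ler_pM => //; first exact: le_trans (fb_map_le u) ub.
have -> : z = - fb_residual u - gamma *: (B u - B y).
  by apply: (dot_ext hdot) => w; rewrite /z !(dotE dot); field; rewrite gt_eqF.
by rewrite (le_trans (ler_normB _ _))// normrN normrZ gtr0_norm.
Qed.

End forward_backward.

(** * Absolutely continuous functions with nonpositive slopes *)

Section absolute_continuity.
Context {R : realType}.
Implicit Types (a b c s t : R) (f : R -> R).

(** Cousin's lemma in the form of a continuous induction: P propagates along
    every step that starts or ends at t and is shorter than the gauge at t, so
    the supremum of the points of [a, b] with P is b and satisfies P. *)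
Lemma gauge_induction (P : R -> Prop) a b : a <= b -> P a ->
  (forall t, a <= t <= b -> exists2 e, 0 < e &
     forall s, a <= s <= b -> `|s - t| < e ->
       (s <= t -> P s -> P t) /\ (t <= s -> P t -> P s)) ->
  P b.
Proof.
move=> ab Pa gauge; pose S := [set c | a <= c <= b /\ P c].
have Sa : S a by split => //; rewrite lexx.
have supS : has_sup S by split; [exists a|exists b => c [/andP[]]].
have aS : a <= sup S by apply: ub_le_sup => //; exact: supS.2.
have Sb : sup S <= b by apply: ge_sup => //; [exists a|move=> c [/andP[]]].
have [|e e0 he] := gauge (sup S); first by rewrite aS.
have [c [/andP[ac cb] Pc] ltc] := sup_adherent e0 supS.
have cS : c <= sup S by apply: ub_le_sup => //; [exact: supS.2|split => //; rewrite ac].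
have PS : P (sup S).
  have [||+ _] := he c; first by rewrite ac.
    by rewrite ler0_norm ?subr_le0// opprB ltrBlDr addrC -ltrBlDr.
  exact.
have [ltSb|] := ltP (sup S) b; last first.
  by move=> leb; have <- : sup S = b by apply/eqP; rewrite eq_le Sb leb.
pose s := Num.min b (sup S + e / 2).
have sS : sup S < s by rewrite lt_min ltSb/= ltrDl divr_gt0.
have sb : s <= b by rewrite ge_min lexx.
have as_ : a <= s by exact: le_trans aS (ltW sS).
have Ps : P s.
  have [||_] := he s; first by rewrite as_.
    rewrite gtr0_norm ?subr_gt0// ltrBlDl gt_min; apply/orP; right.
    by rewrite ltrD2l ltr_pdivrMr// ltr_pMr// ltr1n.
  by apply => //; exact: ltW.
have : s <= sup S by apply: ub_le_sup => //; [exact: supS.2|split => //; rewrite as_].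
by rewrite leNgt sS.
Qed.

(** The completed measure is the outer measure, so a null set has a cover by
    half-open intervals of small total length; outer regularity then provides
    the open set. *)
Lemma negligible_open_cover (N : set R) :
  (@completed_lebesgue_measure R).-negligible N ->
  forall d : R, 0 < d -> exists G : set R,
    [/\ open G, N `<=` G & (@lebesgue_measure R G < d%:E)%E].
Proof.
move=> [M [mM M0 NM]] d d0.
have d2 : 0 < d / 2 by rewrite divr_gt0.
have /ereal_inf_lt[z [/= F [mF MF] <-] zd] :
   (@completed_lebesgue_measure R M < (d / 2)%:E)%E by rewrite M0 lte_fin.
pose D := \bigcup_k F k.
have mF' k : measurable (F k : set (measurableTypeR R)).
  by apply: sub_sigma_algebra; exact: mF.
have mD : measurable (D : set (measurableTypeR R)) by exact: bigcupT_measurable.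
have Dd : (@lebesgue_measure R D < (d / 2)%:E)%E.
  apply: le_lt_trans zd.
  apply: le_trans (outer_measure_sigma_subadditive (wlength (@idfun R))^*%mu F) _.
  apply: lee_nneseries => // k _.
  by rewrite -((measurable_mu_extE (wlength (@idfun R))) (F k))//; exact: mF.
have [|G [oG DG GD]] := lebesgue_regularity_outer mD _ d2.
  by apply: lt_trans Dd _; exact: ltry.
exists G; split => //; first exact: subset_trans NM (subset_trans MF DG).
have mG : measurable (G : set (measurableTypeR R)) by exact: open_measurable.
rewrite -(setDUK DG) measureU//; last 2 first.
- exact: measurableD.
- by rewrite setDE setICA setICr setI0.
by rewrite [d]splitr EFinD lteD.
Qed.

Lemma sum_lengths_le (G : set R) n (u v : nat -> R) :
  measurable (G : set (measurableTypeR R)) ->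
  (forall i, (i < n)%N -> u i <= v i) ->
  (forall i, (i < n)%N -> [set` `]u i, v i[] `<=` G) ->
  trivIset setT (fun i : 'I_n => [set` `]u i, v i[]) ->
  ((\sum_(i < n) (v i - u i))%:E <= @lebesgue_measure R G)%E.
Proof.
move=> mG uv sub triv; rewrite -sumEFin.
have -> : (\sum_(i < n) (v i - u i)%:E)%E =
   (\sum_(i < n) @lebesgue_measure R [set` `]u i, v i[])%E.
  apply: eq_bigr => i _; rewrite lebesgue_measure_itv/= lte_fin.
  have := uv i (ltn_ord i); rewrite le_eqVlt => /orP[/eqP ->|->]; last by rewrite EFinB.
  by rewrite ltxx subrr.
rewrite -(measure_semi_additive_ord (@lebesgue_measure R))//; last first.
  by apply: bigsetU_measurable => i _; exact: measurable_itv.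
apply: le_measure; rewrite ?inE//.
- by apply: bigsetU_measurable => i _; exact: measurable_itv.
- rewrite -(bigcup_mkord n (fun i => [set` `]u i, v i[])).
  by move=> x [i /= ltin]; exact: sub.
Qed.

(** The upper derivative of f at t relative to [a, b] is at most c; the
    product with s - t treats both sides of t at once. *)
Definition slope_le a b f t c := forall e, 0 < e -> exists2 d, 0 < d &
  forall s, a <= s <= b -> `|s - t| < d ->
    (f s - f t) * (s - t) <= (c + e) * (s - t) ^+ 2.

(** Cover the exceptional null set by an open set G of measure below the
    threshold d of absolute continuity for eps / 2. Advance from a to b by
    steps which are either based at a point outside the null set, where f
    grows at rate at most e, or contained in G; the latter are disjoint of
    total length < d, so they contribute at most eps / 2. *)
Lemma ac_le a b f : a <= b -> absolutely_continuous a b f ->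
  {ae (@completed_lebesgue_measure R), forall t : R, a <= t <= b -> slope_le a b f t 0} ->
  f b <= f a.
Proof.
move=> ab acf negN.
apply/ler_addgt0Pr => eps eps0.
have eps2 : 0 < eps / 2 by rewrite divr_gt0.
have [d d0 hd] := acf _ eps2.
have [G [oG NG Gd]] := negligible_open_cover negN d0.
have mG : measurable (G : set (measurableTypeR R)) by exact: open_measurable.
pose e := eps / 2 / (b - a + 1).
have ba1 : 0 < b - a + 1 by rewrite ltr_wpDl// subr_ge0.
have e0 : 0 < e by rewrite divr_gt0.
(* Disjoint intervals in G, in increasing order, that end before c: the steps
   of the second kind made so far. *)
pose good n (u v : nat -> R) c := [/\ 
  forall i, (i < n)%N -> [/\ a <= u i, u i <= v i & v i <= c],
  forall i, (i < n)%N -> [set` `]u i, v i[] `<=` G &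
  forall i j, (i < j < n)%N -> v i <= u j].
pose P c := exists n u v, good n u v c /\
  f c - f a <= e * (c - a) + \sum_(i < n) `|f (v i) - f (u i)|.
have : P b.
  apply: (gauge_induction ab).
    exists 0, (fun=> a), (fun=> a); split; first by split => // i j; rewrite ltn0 ?andbF.
    by rewrite big_ord0 !subrr mulr0 addr0.
  have extend s t n u v : good n u v s -> s <= t -> good n u v t.
    move=> [h1 h2 h3] st; split => // i ltin; have [? ? h] := h1 i ltin.
    by split => //; exact: le_trans h st.
  have append s t n u v : good n u v s -> a <= s <= t -> [set` `]s, t[] `<=` G ->
      good n.+1 (fun i => if i == n then s else u i) (fun i => if i == n then t else v i) t.
    move=> [h1 h2 h3] /andP[as_ st] stG; split => [i|i|i j].
    - rewrite ltnS; case: eqVneq => [-> //|ne le]; have [] := h1 i.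
        by rewrite ltn_neqAle ne.
      by move=> ? ? h; split => //; exact: le_trans h st.
    - rewrite ltnS; case: eqVneq => [-> //|ne le]; apply: h2.
      by rewrite ltn_neqAle ne.
    - rewrite ltnS => /andP[ij jn]; have -> : (i == n) = false.
        by apply/negbTE; rewrite neq_ltn (leq_trans ij jn).
      have ltin := leq_trans ij jn.
      case: eqVneq => [ejn|ne]; first by have [] := h1 i ltin.
      by apply: h3; rewrite ij ltn_neqAle ne.
  move=> t tab; have [Gt|nGt] := pselect (G t); last first.
    have /(_ tab e e0)[d1 d10 hd1] : a <= t <= b -> slope_le a b f t 0.
      by apply: contrapT => nt; apply/nGt/NG.
    exists d1 => // s sab std; have := hd1 s sab std; rewrite add0r.
    have [->|nst] := eqVneq s t; first by [].
    move=> le1; split=> st [n [u [v [gd le2]]]]; exists n, u, v; split.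
    - exact: extend gd st.
    - have st0 : 0 < t - s by rewrite subr_gt0 lt_neqAle nst.
      have : f t - f s <= e * (t - s).
        by rewrite -(ler_pM2r st0) -mulrA -expr2 -mulrNN !opprB -sqrrN opprB.
      lra.
    - exact: extend gd st.
    - have st0 : 0 < s - t by rewrite subr_gt0 lt_neqAle eq_sym nst.
      have : f s - f t <= e * (s - t) by rewrite -(ler_pM2r st0) -mulrA -expr2.
      lra.
  have /nbhs_ballP[r /= r0 rG] : nbhs t G by exact: open_nbhs_nbhs.
  have inG p q : p <= t <= q -> `|p - t| < r -> `|q - t| < r -> [set` `]p, q[] `<=` G.
    move=> /andP[pt tq] pr qr z /=; rewrite in_itv/= => /andP[pz zq].
    apply: rG; rewrite /ball/=.
    move: pr qr; rewrite !ltr_norml => /andP[? ?] /andP[? ?]; apply/andP; split; lra.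
  have addlast p q n u v : a <= p <= q -> [set` `]p, q[] `<=` G -> good n u v p ->
      f p - f a <= e * (p - a) + \sum_(i < n) `|f (v i) - f (u i)| -> P q.
    move=> apq pqG gd le1; have := append _ _ _ _ _ gd apq pqG => gd'.
    exists n.+1; eexists; eexists; split; first exact: gd'.
    rewrite big_ord_recr /= eqxx.
    under eq_bigr => i _ do rewrite (ltn_eqF (ltn_ord i)).
    have := ler_norm (f q - f p).
    have : e * (p - a) <= e * (q - a).
      by rewrite ler_pM2l// lerD2r; case/andP: apq.
    lra.
  exists r => // s sab srt; case/andP: sab => as_ sb; case/andP: tab => at_ tb.
  split=> st [n [u [v [gd le2]]]].
  - by apply: addlast gd le2; [rewrite as_|apply: inG; rewrite ?st ?subrr ?normr0/=].
  - by apply: addlast gd le2; [rewrite at_|apply: inG; rewrite ?st ?lexx ?subrr ?normr0/=].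
move=> [n [u [v [[h1 h2 h3] le1]]]].
have triv : trivIset setT (fun i : 'I_n => [set` `]u i, v i[]).
  apply/trivIsetP => i j _ _; wlog : i j / (i < j)%N.
    move=> wl; rewrite neq_ltn => /orP[ij|ji]; first by apply: wl => //; rewrite neq_ltn ij.
    by rewrite setIC; apply: wl => //; rewrite neq_ltn ji.
  move=> ij _; apply/seteqP; split => // z [/=]; rewrite !in_itv/= => /andP[_ zv] /andP[uz _].
  have := h3 i j; rewrite ij ltn_ord => /(_ isT) le2.
  by have := lt_trans (lt_le_trans zv le2) uz; rewrite ltxx.
have lt1 : \sum_(i < n) (v i - u i) < d.
  rewrite -lte_fin; apply: le_lt_trans Gd; apply: sum_lengths_le => //.
  by move=> i ltin; have [] := h1 i ltin.
have := hd n (fun i => u i) (fun i => v i) (fun i => h1 i (ltn_ord i)) triv lt1.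
have : e * (b - a) <= eps / 2.
  have le_ba : (b - a + 1)^-1 * (b - a) <= 1.
    by rewrite mulrC ler_pdivrMr// mul1r lerDl.
  by rewrite /e -mulrA ler_piMr// ltW.
lra.
Qed.

End absolute_continuity.

(** * Integrals of derivatives of nonincreasing functions *)

Section energy.
Context {R : realType}.
Local Notation mu := (@completed_lebesgue_measure R).

Lemma le_limn_einf (u : (\bar R)^nat) (c : \bar R) :
  (\forall n \near \oo, (c <= u n)%E) -> (c <= limn_einf u)%E.
Proof.
move=> h; rewrite /limn_einf leeNr /limn_esup /limf_esup.
apply: ge_ereal_inf.
exists (ereal_sup ((\- u)%E @` [set n | (c <= u n)%E])).
  by exists [set n | (c <= u n)%E].
by apply: ge_ereal_sup => _ [n /= cn <-]; rewrite leeN2.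
Qed.

Lemma ae_impl d (T : semiRingOfSetsType d) (nu : set T -> \bar R) (P Q : T -> Prop) :
  (forall t, P t -> Q t) -> {ae nu, forall t, P t} -> {ae nu, forall t, Q t}.
Proof. move=> PQ [A [mA A0 PA]]; exists A; split=> // t nQ.
by apply: PA => /PQ. Qed.

Lemma integral_scale_indic d (T : measurableType d)
    (nu : {measure set T -> \bar R}) (D A : set T) (k : R) :
  measurable D -> measurable A -> 0 <= k -> A `<=` D ->
  (\int[nu]_(t in D) (k%:E * (\1_A t)%:E) = k%:E * nu A)%E.
Proof.
move=> mD mA k0 AD; rewrite ge0_integralZl_EFin//.
  by rewrite integral_indic// setIidl.
by apply/measurable_EFinP; apply: measurable_funTS; exact: measurable_indic.
Qed.

Lemma measurable_itv_lebesgue (i : interval R) :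
  measurable ([set` i] : set (lebesgueR R)).
Proof. by apply: sub_caratheodory; exact: measurable_itv. Qed.

Lemma completed_lebesgue_measure_itvcc (a b : R) : a <= b ->
  mu [set` `[a, b]] = (b - a)%:E.
Proof.
move=> ab; have -> : mu [set` `[a, b]] = @lebesgue_measure R [set` `[a, b]] by [].
rewrite lebesgue_measure_itv/= lte_fin; move: ab; rewrite le_eqVlt.
by case/orP => [/eqP ->|->]; [rewrite ltxx subrr|rewrite EFinB].
Qed.

Lemma partition_cell (p : nat -> R) (m : nat) t : p 0%N <= t -> t <= p m.+1 ->
  exists2 i, (i <= m)%N & p i <= t <= p i.+1.
Proof.
move=> p0; elim: m => [|m IH] tm; first by exists 0%N => //; rewrite p0.
have [/IH[i im h]|lt] := leP t (p m.+1); first by exists i => //; exact: leqW.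
by exists m.+1 => //; rewrite (ltW lt).
Qed.

(** On the partition of [0, T] into n + 1 equal cells, the step function whose
    value on a cell is the decrease of f there divided by the length of the
    cell has integral f(0) - f(T). At a point t where f has slope at most
    - g(t), the slope of f over the cell around t is at most - g(t) + e as soon
    as the cell is short, so g is almost everywhere below the lower limit of
    the step functions, and Fatou's lemma applies. *)
Lemma integral_le_decrease (T : R) (f g : R -> R) : 0 < T ->
  (forall s t, 0 <= s -> s <= t -> t <= T -> f t <= f s) ->
  lebesgue_measurable_fun `[0, T] g ->
  (forall t, 0 <= t <= T -> 0 <= g t) ->
  {ae mu, forall t : R, 0 <= t <= T -> slope_le 0 T f t (- g t)} ->
  (\int[mu]_(t in `[0%R, T]) (g t)%:E <= (f 0 - f T)%:E)%E.
Proof.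
move=> T0 ndf mg g0 slope.
pose D := ([set` `[0, T]] : set (lebesgueR R)).
have mD : measurable D by exact: measurable_itv_lebesgue.
pose p (n i : nat) := T * i%:R / n.+1%:R.
have pS n i : p n i.+1 - p n i = T / n.+1%:R.
  by rewrite /p -mulrBl -mulrBr -natr1 addrAC subrr add0r mulr1.
have ple n i : p n i <= p n i.+1 by rewrite -subr_ge0 pS divr_ge0// ltW.
have p0 n : p n 0%N = 0 by rewrite /p mulr0 mul0r.
have pT n : p n n.+1 = T by rewrite /p mulfK.
have p_ge0 n i : 0 <= p n i by rewrite /p divr_ge0// mulr_ge0// ltW.
have p_leT n i : (i <= n.+1)%N -> p n i <= T.
  by move=> le; rewrite /p ler_pdivrMr// ler_pM2l// ler_nat.
pose q n i := (f (p n i) - f (p n i.+1)) / (T / n.+1%:R).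
have Tn n : 0 < T / n.+1%:R by rewrite divr_gt0.
have q0 n (i : 'I_n.+1) : 0 <= q n i.
  rewrite divr_ge0 ?(ltW (Tn _))// subr_ge0; apply: ndf => //.
  by apply: p_leT; rewrite ltn_ord.
(* The cells are closed: at a common endpoint the two values add up, which is
   harmless for a lower bound of the step function. *)
pose F n (i : 'I_n.+1) (t : lebesgueR R) : \bar R :=
  ((q n i)%:E * (\1_([set` `[p n i, p n i.+1]] : set (lebesgueR R)) t)%:E)%E.
have mF n i : measurable_fun D (@F n i).
  apply: emeasurable_funM; first exact: measurable_cst.
  apply/measurable_EFinP; apply: measurable_funTS; apply: measurable_indic.
  exact: measurable_itv_lebesgue.
have F0 n i t : D t -> (0 <= @F n i t)%E.
  by move=> _; rewrite mule_ge0// lee_fin// q0.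
pose step n (t : lebesgueR R) := (\sum_(i < n.+1) @F n i t)%E.
have mstep n : measurable_fun D (step n) by apply: emeasurable_sum => i; exact: mF.
have step0 n t : D t -> (0 <= step n t)%E.
  by move=> Dt; apply: sume_ge0 => i _; exact: F0.
have int_step n : (\int[mu]_(t in D) step n t = (f 0 - f T)%:E)%E.
  rewrite (ge0_integral_sum _ mD (mF n) (F0 n)).
  have -> : f 0 - f T = \sum_(i < n.+1) (f (p n i) - f (p n i.+1)).
    rewrite -(big_mkord xpredT (fun i => f (p n i) - f (p n i.+1))).
    rewrite -[LHS]opprB -[f T](congr1 f (pT n)) -[f 0](congr1 f (p0 n)).
    rewrite -(telescope_sumr (fun i => f (p n i)) (leq0n _)) -sumrN.
    by apply: eq_bigr => i _; rewrite opprB.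
  rewrite -sumEFin; apply: eq_bigr => i _.
  rewrite (integral_scale_indic (@completed_lebesgue_measure R) mD (measurable_itv_lebesgue _) (q0 n i)); last first.
    move=> z /=; rewrite /D/= !in_itv/= => /andP[pz zp].
    rewrite (le_trans (p_ge0 _ _) pz)/=; apply: le_trans zp _.
    by apply: p_leT; rewrite ltn_ord.
  rewrite [X in (_ * X)%E](completed_lebesgue_measure_itvcc (ple n i)) pS -EFinM.
  by rewrite /q divfK// gt_eqF.
have ae_le : {ae mu, forall t, D t -> ((g t)%:E <= limn_einf (step^~ t))%E}.
  apply: ae_impl slope => t slope; rewrite /D/= in_itv/= => tT.
  apply/lee_addgt0Pr => e e0.
  have [d d0 hd] := slope tT e e0.
  have dT : 0 < d / T by rewrite divr_gt0.
  rewrite -leeBlDr// -EFinB; apply: le_limn_einf.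
  have := near_infty_natSinv_lt (PosNum dT); apply: filterS => n /= nd.
  have Tnd : T / n.+1%:R < d by rewrite mulrC -ltr_pdivlMr.
  have [i ile /andP[pt tp]] : exists2 i, (i <= n)%N & p n i <= t <= p n i.+1.
    by case/andP: tT => t0 tT; apply: partition_cell; rewrite ?p0 ?pT.
  have ilt : (i < n.+1)%N by rewrite ltnS.
  apply: (@le_trans _ _ (@F n (Ordinal ilt) t)); last first.
    rewrite /step (bigD1 (Ordinal ilt))//= leeDl// sume_ge0// => j _.
    by apply: F0; rewrite /D/= in_itv.
  rewrite /F/= indicE mem_set ?mule1/=; last by rewrite in_itv/= pt.
  rewrite lee_fin /q ler_pdivlMr//.
  have := pS n i; move: (p_ge0 n i) (p_leT n i.+1 ilt) => pi0 piT pSi.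
  have h1 : f (p n i.+1) - f t <= (- g t + e) * (p n i.+1 - t).
    have [->|ne] := eqVneq (p n i.+1) t; first by rewrite !subrr mulr0.
    have gt0 : 0 < p n i.+1 - t by rewrite subr_gt0 lt_neqAle eq_sym ne.
    rewrite -(ler_pM2r gt0) -[X in _ <= X]mulrA -expr2; apply: hd.
      by rewrite piT (le_trans pi0 (ple n i)).
    by rewrite gtr0_norm//; apply: le_lt_trans Tnd; rewrite -pSi lerB.
  have h2 : f t - f (p n i) <= (- g t + e) * (t - p n i).
    have [->|ne] := eqVneq (p n i) t; first by rewrite !subrr mulr0.
    have gt0 : 0 < t - p n i by rewrite subr_gt0 lt_neqAle ne.
    have ptd : `|p n i - t| < d.
      by rewrite distrC gtr0_norm//; apply: le_lt_trans Tnd; rewrite -pSi lerB.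
    have pin : 0 <= p n i <= T by rewrite pi0 (le_trans (ple n i) piT).
    have := hd _ pin ptd.
    rewrite -[X in X * _](opprB (f t)) -(opprB t) mulrNN sqrrN expr2 mulrA.
    by rewrite ler_pM2r.
  rewrite -pSi; lra.
apply: le_trans (ae_ge0_le_integral mD _ _ _ _ ae_le) _.
- by move=> t; rewrite /D/= in_itv/= lee_fin; exact: g0.
- exact/measurable_EFinP.
- by move=> t Dt; apply: le_limn_einf; apply: nearW => n; exact: step0.
- rewrite /limn_einf; apply: measurableT_comp; first exact: oppe_measurable.
  apply: measurable_fun_limn_esup => n; apply: measurableT_comp => //.
apply: le_trans (fatou _ mD mstep step0) _.
rewrite (_ : (fun n => _) = cst (f 0 - f T)%:E); last first.
  by apply/funext => n; rewrite int_step.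
have cst_cvg : cst (f 0 - f T)%:E @ \oo --> (f 0 - f T)%:E by exact: cvg_cst.
by rewrite (cvg_limn_einf_sup cst_cvg).1.
Qed.

End energy.

(** * Trajectories *)

Section flow.
Context {R : realType} {X : completeNormedModType R}.

Lemma is_derive_linear_approx (x : R -> X) (t : R) (v : X) : is_derive t 1 x v ->
  forall e, 0 < e -> exists2 d, 0 < d &
    forall s, `|s - t| < d -> `|x s - x t - (s - t) *: v| <= e * `|s - t|.
Proof.
move=> [xt vE] e e0.
have : (fun h => h^-1 *: (x (h *: 1 + t) - x t)) @ 0^' --> v.
  by rewrite -vE; exact: xt.
move=> /cvgrPdist_le /(_ e e0); rewrite near_withinE => /nbhs_ballP[d /= d0 hd].
exists d => // s std; have [->|st] := eqVneq s t.
  by rewrite !subrr scale0r subr0 !normr0 mulr0.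
have st0 : s - t != 0 by rewrite subr_eq0.
have := hd (s - t); rewrite /ball/= sub0r normrN => /(_ std st0).
rewrite [_ *: 1]mulr1 subrK => le1.
have -> : x s - x t - (s - t) *: v = (s - t) *: - (v - (s - t)^-1 *: (x s - x t)).
  by rewrite opprB scalerBr scalerA divff// scale1r.
by rewrite normrZ normrN mulrC ler_wpM2r.
Qed.

Lemma ac_lipschitz (a b K : R) (x : R -> X) (g : R -> R) : 0 < K ->
  (forall s t, `|g s - g t| <= K * `|x s - x t|) ->
  absolutely_continuous a b x -> absolutely_continuous a b g.
Proof.
move=> K0 gK acx e e0; have [d d0 hd] := acx (e / K) (divr_gt0 e0 K0).
exists d => // n u v uv triv sumd; have := hd n u v uv triv sumd.
rewrite ltr_pdivlMr// mulrC; apply: le_lt_trans.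
by rewrite mulr_sumr; apply: ler_sum => i _.
Qed.

Lemma ac_subitv (a b c d : R) (x : R -> X) : a <= c -> d <= b ->
  absolutely_continuous a b x -> absolutely_continuous c d x.
Proof.
move=> ac db acx e e0; have [r r0 hr] := acx e e0.
exists r => // n u v uv; apply: hr => i; have [cu ui vd] := uv i.
by split => //; [exact: le_trans cu|exact: le_trans db].
Qed.

Variables (r : X -> X) (lambda : R -> R) (delta : R) (x : R -> X).
Hypothesis hdelta : 0 < delta.
Hypothesis hlambda : forall t : R, 0 <= t -> 0 <= lambda t <= delta.
Hypothesis acx : forall a, 0 < a -> absolutely_continuous 0 a x.
Hypothesis dx : {ae (@completed_lebesgue_measure R), forall t : R, 0 <= t ->
  is_derive t 1 x (lambda t *: r (x t))}.

(** At a point where x' = lambda r(x), the trajectory agrees to first order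
    with an Euler step, forward or backward, and N, being Lipschitz, changes by
    o(|w - u|) between the two; hence the slopes of N along x are almost
    everywhere nonpositive. *)
Lemma lyapunov_nonincreasing (N : X -> R) (K : R) : 0 < K ->
  (forall u v, `|N u - N v| <= K * `|u - v|) ->
  (forall s u, 0 <= s <= 1 -> N (u + s *: r u) <= N u) ->
  (forall s u, 0 <= s -> N u <= N (u - s *: r u)) ->
  forall s t, 0 <= s -> s <= t -> N (x t) <= N (x s).
Proof.
move=> K0 NK fwd bwd s t s0 st.
have [->//|nst] := eqVneq s t.
have t0 : 0 < t by rewrite (le_lt_trans s0)// lt_neqAle nst.
apply: (@ac_le _ s t (N \o x) st).
  apply: (@ac_lipschitz _ _ K x) => //; first by move=> ? ?; exact: NK.
  exact: (ac_subitv s0 (lexx t) (acx t0)).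
apply: ae_impl dx => u du /andP[su ut]; have u0 := le_trans s0 su.
have /andP[l0 ld] := hlambda u0.
move=> e e0; have [d d0 hd] := is_derive_linear_approx (du u0) (divr_gt0 e0 K0).
(* The bound 1 / delta makes the forward step (w - u) lambda(u) at most 1. *)
exists (Num.min d delta^-1); first by rewrite lt_min d0 invr_gt0.
move=> w _; rewrite lt_min => /andP[/hd le1 ltd]; rewrite add0r /=.
rewrite scalerA in le1.
have {}le1 : K * `|x w - (x u + ((w - u) * lambda u) *: r (x u))| <= e * `|w - u|.
  rewrite opprD addrA.
  by have := ler_wpM2l (ltW K0) le1; rewrite mulrA mulrCA divff ?gt_eqF// mulr1.
have := le_trans (NK _ _) le1; rewrite ler_norml => /andP[le2 le3].
have [wu|uw] := leP w u.
  have := bwd ((u - w) * lambda u) (x u).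
  rewrite -scaleNr -mulNr opprB mulr_ge0 ?subr_ge0// => /(_ isT) le4.
  have wu0 : 0 <= u - w by rewrite subr_ge0.
  move: le2 le3; rewrite ler0_norm ?subr_le0// opprB => le2 le3.
  have : (N (x u) - N (x w)) * (u - w) <= e * (u - w) * (u - w).
    by apply: ler_wpM2r => //; lra.
  lra.
have uw0 : 0 < w - u by rewrite subr_gt0.
have := fwd ((w - u) * lambda u) (x u).
rewrite mulr_ge0 ?(ltW uw0)//=.
have -> : (w - u) * lambda u <= 1.
  apply: le_trans (ler_wpM2l (ltW uw0) ld) _.
  by rewrite -ler_pdivlMr// div1r ltW// -(gtr0_norm uw0).
move=> /(_ isT) le4.
move: le2 le3; rewrite gtr0_norm// => le2 le3.
have : (N (x w) - N (x u)) * (w - u) <= e * (w - u) * (w - u).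
  by apply: ler_wpM2r; [exact: ltW|lra].
lra.
Qed.

End flow.

Lemma le_integralZl d (T : measurableType d) (R : realType)
    (nu : {measure set T -> \bar R}) (D : set T) (g : T -> R) (k K : R) :
  measurable D -> measurable_fun D g -> (forall t, D t -> 0 <= g t) -> 0 <= k ->
  (K%:E <= \int[nu]_(t in D) (g t)%:E)%E ->
  ((k * K)%:E <= \int[nu]_(t in D) (k * g t)%:E)%E.
Proof.
move=> mD mg g0 k0 le1; under eq_integral do rewrite EFinM.
rewrite ge0_integralZl_EFin//; first by rewrite EFinM lee_wpmul2l.
exact/measurable_EFinP.
Qed.

Section distance.
Context {R : realType} {X : completeNormedModType R} (dot : {dot X for idfun}).
Hypothesis hdot : norm_of_dot dot.

Lemma slope_sqr_dist (a b : R) (x : R -> X) (y v : X) (t : R) :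
  is_derive t 1 x v ->
  slope_le a b (fun s => `|x s - y| ^+ 2) t (2 * dot (x t - y) v).
Proof.
move=> dx e e0; set q := x t - y.
have q1 : 0 < 4 * (`|q| + 1) by rewrite mulr_gt0// ltr_wpDl.
have v1 : 0 < 2 * (`|v| + 1) ^+ 2 by rewrite mulr_gt0// exprn_gt0// ltr_wpDl.
(* These bounds make the error terms 2 <q, rho> (s - t) and
   |(s - t) v + rho|^2 (s - t) at most e (s - t)^2 / 2 each. *)
pose e1 := Num.min 1 (e / (4 * (`|q| + 1))).
have e10 : 0 < e1 by rewrite lt_min ltr01 divr_gt0.
have [d d0 hd] := is_derive_linear_approx dx e10.
exists (Num.min d (e / (2 * (`|v| + 1) ^+ 2))); first by rewrite lt_min d0 divr_gt0.
move=> s _; rewrite lt_min => /andP[/hd].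
set rho := _ - (s - t) *: v => rle; rewrite ltr_pdivlMr// => ste.
have e11 : e1 <= 1 by rewrite ge_min lexx.
have e1q : e1 * (4 * (`|q| + 1)) <= e by rewrite -ler_pdivlMr// ge_min lexx orbT.
have xs : x s - y = q + ((s - t) *: v + rho).
  by apply: (dot_ext hdot) => w; rewrite /q /rho !(dotE dot); ring.
have wle : `|(s - t) *: v + rho| <= (`|v| + 1) * `|s - t|.
  rewrite (le_trans (ler_normD _ _))// normrZ mulrDl mul1r mulrC lerD2l.
  by apply: le_trans rle _; rewrite ler_piMl.
have w2 : `|(s - t) *: v + rho| ^+ 2 <= (`|v| + 1) ^+ 2 * `|s - t| ^+ 2.
  by rewrite -exprMn ler_pXn2r// nnegrE// (le_trans (normr_ge0 _) wle).
have -> : `|x s - y| ^+ 2 = `|q| ^+ 2 + 2 * dot q v * (s - t) + 2 * dot q rho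
    + `|(s - t) *: v + rho| ^+ 2.
  rewrite xs; clearbody q rho.
  rewrite !hdot !(dotE dot) (dotC dot v q) (dotC dot rho q) (dotC dot rho v); ring.
have crho : 2 * dot q rho * (s - t) <= e / 2 * (s - t) ^+ 2.
  apply: le_trans (ler_norm _) _; rewrite 2!normrM normr_nat.
  have cs : `|dot q rho| <= `|q| * `|rho|.
    rewrite ler_norml dot_le_norm// andbT lerNl -(dotNl dot) -[`|q|]normrN.
    exact: dot_le_norm.
  have h1 : `|q| * `|rho| <= `|q| * (e1 * `|s - t|) by rewrite ler_wpM2l.
  have h2 : `|dot q rho| * `|s - t| <= `|q| * (e1 * `|s - t|) * `|s - t|.
    by rewrite ler_wpM2r// (le_trans cs).
  have h3 : e1 * `|q| <= e / 4 by move: e1q; lra.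
  have := ler_wpM2r (sqr_ge0 `|s - t|) h3.
  rewrite -(real_normK (num_real (s - t))).
  lra.
have cw : `|(s - t) *: v + rho| ^+ 2 * (s - t) <= e / 2 * (s - t) ^+ 2.
  apply: le_trans (ler_norm _) _; rewrite normrM ger0_norm ?sqr_ge0//.
  rewrite -(real_normK (num_real (s - t))).
  apply: le_trans (ler_wpM2r (normr_ge0 _) w2) _.
  have h : (`|v| + 1) ^+ 2 * `|s - t| <= e / 2 by move: ste; lra.
  have := ler_wpM2r (sqr_ge0 `|s - t|) h; lra.
move: crho cw; move: (dot q v) (dot q rho) (`|_ + rho| ^+ 2) (`|q| ^+ 2) => A1 A2 A3 A4.
move=> c1 c2; lra.
Qed.

End distance.

Section residual_decay.
Context {R : realType} {X : completeNormedModType R} (dot : {dot X for idfun}).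
Hypothesis hdot : norm_of_dot dot.
Variables (A : X -> set X) (B : X -> X) (beta gamma delta : R).
Hypotheses (hA : maximally_monotone dot A) (hB : cocoercive dot beta B).
Hypotheses (hbeta : 0 < beta) (hgamma : 0 < gamma < 2 * beta).
Variable y : X.
Hypothesis hy : zer (sv_add A (sv_of B)) y.
Hypothesis hdelta : delta = Num.min 1 (beta / gamma) + 1 / 2.
Variables (lambda : R -> R) (x0 : X) (x : R -> X).
Hypothesis hlambda : forall t : R, 0 <= t -> 0 <= lambda t <= delta.
Hypothesis hx : strong_global_solution A B gamma lambda x0 x.

Local Notation r := (fb_residual A B gamma).

Let delta1 : 1 < delta := delta_gt1 hgamma hdelta.

Let acx : forall a, 0 < a -> absolutely_continuous 0 a x.
Proof. by case: hx. Qed.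

Let dx : {ae (@completed_lebesgue_measure R), forall t : R, 0 <= t ->
  is_derive t 1 x (lambda t *: r (x t))}.
Proof. by case: hx. Qed.

(** The forward step is a convex combination of u and T u, and T does not
    increase the distance to y; the backward step uses <u - y, r u> <= 0. *)
Lemma dist_nonincreasing s t : 0 <= s -> s <= t -> `|x t - y| <= `|x s - y|.
Proof.
apply: (lyapunov_nonincreasing (lt_trans ltr01 delta1) hlambda acx dx
  (N := fun u => `|u - y|) ltr01) => [u v|{}s u /andP[s0 s1]|{}s u s0].
- rewrite mul1r (le_trans (ler_dist_dist _ _))//.
  by rewrite opprB addrA subrK.
- have -> : u + s *: r u - y = (1 - s) *: (u - y) + s *: (fb_map A B gamma u - y).
    by apply: (dot_ext hdot) => w; rewrite /fb_residual !(dotE dot); ring.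
  apply: le_trans (ler_normD _ _) _; rewrite !normrZ !ger0_norm ?subr_ge0//.
  have := ler_wpM2l s0 (fb_map_le hdot hA hB hbeta hgamma hy hdelta u).
  lra.
- rewrite -(@ler_pXn2r _ 2)// ?nnegrE//.
  have := fb_residual_dot hdot hA hB hbeta hgamma hy hdelta u.
  have -> : u - s *: r u - y = (u - y) - s *: r u by rewrite addrAC.
  move: (u - y) (r u) => q w qw.
  rewrite [X in _ <= X]hdot !(dotE dot) -!hdot (dotC dot w q).
  have : s * dot q w <= 0.
    rewrite mulr_ge0_le0// (le_trans qw)// oppr_le0 mulr_ge0 ?sqr_ge0//.
    by rewrite divr_ge0// (le_trans _ (ltW delta1)).
  have : 0 <= s * (s * `|w| ^+ 2) by rewrite !mulr_ge0 ?sqr_ge0.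
  lra.
Qed.

Lemma residual_nonincreasing s t : 0 <= s -> s <= t -> `|r (x t)| <= `|r (x s)|.
Proof.
apply: (lyapunov_nonincreasing (lt_trans ltr01 delta1) hlambda acx dx
  (N := fun u => `|r u|) (ltr0n R 2)).
- move=> u v; apply: le_trans (ler_dist_dist _ _) _.
  exact: (fb_residual_lip hdot hA hB hbeta hgamma hy hdelta).
- move=> *; exact: (fb_residual_forward hdot hA hB hbeta hgamma hy hdelta).
- move=> *; exact: (fb_residual_backward hdot hA hB hbeta hgamma hy hdelta).
Qed.

(** The squared distance to y decreases at rate at least
    lambda delta |r x|^2 >= |r(x(T))|^2 g. *)
Lemma residual_integral_le (T K : R) (g : R -> R) : 0 < T ->
  lebesgue_measurable_fun `[0, T] g ->
  (forall t, 0 <= t <= T -> 0 <= g t <= lambda t * delta) ->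
  (K%:E <= \int[@completed_lebesgue_measure R]_(t in `[0%R, T]) (g t)%:E)%E ->
  `|r (x T)| ^+ 2 * K <= `|x0 - y| ^+ 2.
Proof.
move=> T0 mg gb leK; set rho := _ ^+ 2.
have rho0 : 0 <= rho by exact: sqr_ge0.
have g0 t : `[0, T]%classic t -> 0 <= g t.
  by rewrite /= in_itv/= => /gb/andP[].
have mD := measurable_itv_lebesgue `[0, T].
have le1 := le_integralZl mD mg g0 rho0 leK.
rewrite -lee_fin; apply: le_trans le1 _.
apply: (@le_trans _ _ (`|x 0 - y| ^+ 2 - `|x T - y| ^+ 2)%:E); last first.
  by case: hx => _ -> _; rewrite lee_fin gerBl sqr_ge0.
apply: (@integral_le_decrease _ T (fun t => `|x t - y| ^+ 2) (fun t => rho * g t)) => //.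
- move=> s t s0 st tT; rewrite ler_pXn2r// ?nnegrE//; exact: dist_nonincreasing.
- by apply: measurable_funM => //; exact: measurable_cst.
- by move=> t /gb/andP[gt0 _]; rewrite mulr_ge0.
- apply: ae_impl dx => t dxt tT; have /andP[t0 leT] := tT.
  have /andP[gt0 gle] := gb t tT.
  have le2 : 2 * dot (x t - y) (lambda t *: r (x t)) <= - (rho * g t).
    rewrite (dotZr dot).
    have l0 : 0 <= lambda t by case/andP: (hlambda t0).
    have := ler_wpM2l l0 (fb_residual_dot hdot hA hB hbeta hgamma hy hdelta (x t)).
    have rle : rho <= `|r (x t)| ^+ 2.
      by rewrite ler_pXn2r// ?nnegrE//; exact: residual_nonincreasing.
    have := ler_pM rho0 gt0 rle gle.
    lra.
  move=> e e0; have [d d0 hd] := slope_sqr_dist hdot 0 T y (dxt t0) e0.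
  exists d => // s sT st; apply: le_trans (hd s sT st) _.
  by rewrite ler_wpM2r ?sqr_ge0// lerD2r.
Qed.

End residual_decay.

Lemma measurable_fun_mul_cstB d (T : measurableType d) (R : realType)
    (D : set T) (f : T -> R) (c : R) :
  measurable_fun D f -> measurable_fun D (fun t => f t * (c - f t)).
Proof.
by move=> mf; apply: measurable_funM => //; exact: measurable_funB.
Qed.

(** * Rates of convergence *)

Section rates.
Context {R : realType} {X : completeNormedModType R} (dot : {dot X for idfun}).
Hypothesis hdot : norm_of_dot dot.
Variables (A : X -> set X) (B : X -> X) (beta gamma delta : R).
Hypotheses (hA : maximally_monotone dot A) (hB : cocoercive dot beta B).
Hypotheses (hbeta : 0 < beta) (hgamma : 0 < gamma < 2 * beta).
Variable y : X.
Hypothesis hy : zer (sv_add A (sv_of B)) y.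
Hypothesis hdelta : delta = Num.min 1 (beta / gamma) + 1 / 2.
Variables (lambda : R -> R) (x0 : X) (x : R -> X).
Hypothesis hlambda : forall t : R, 0 <= t -> 0 <= lambda t <= delta.
Hypothesis hx : strong_global_solution A B gamma lambda x0 x.
Variable b : nat.
Hypothesis hb : `|x0 - y| <= b%:R.
Variable phi : R -> R.
Hypothesis hphi : monotonicity_modulus phi.

Local Notation r := (fb_residual A B gamma).

Let gamma0 : 0 < gamma. Proof. by case/andP: hgamma. Qed.
Let delta1 : 1 < delta := delta_gt1 hgamma hdelta.

Lemma dist_le_b t : 0 <= t -> `|x t - y| <= b%:R.
Proof.
move=> t0; apply: le_trans hb; case: (hx) => _ <- _.
exact: (dist_nonincreasing hdot hA hB hbeta hgamma hy hdelta hlambda hx (lexx 0)).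
Qed.

Lemma modulus_gt0 e : 0 < e -> 0 < phi e.
Proof.
move=> e0; case: hphi => ge0 _ eq0; rewrite lt_def ge0 ?ltW// andbT.
by apply/eqP => /(eq0 _ (ltW e0)) h; move: e0; rewrite h ltxx.
Qed.

(** Since phi need not be strictly increasing, only a strict inequality between
    its values can be inverted. *)
Lemma modulus_lt_inv e s : 0 <= e -> 0 <= s -> phi s < phi e -> s < e.
Proof.
move=> e0 s0; rewrite !ltNge; apply: contraNN => es.
by case: hphi => _ mono _; exact: mono.
Qed.

Lemma rate_converges (rho : R -> R) :
  (forall e, 0 < e -> forall t, rho e <= t -> `|x t - y| <= e) ->
  converges_with_rate x y rho.
Proof.
move=> rate; split => //; apply/cvgrPdist_le => e e0.
exists (rho e); split; first exact: num_real.
by move=> t /ltW te; rewrite distrC; exact: rate.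
Qed.
Lemma forward_dist_lt t e : (0 < b)%N -> 0 < e -> 0 <= t ->
  `|r (x t)| < gamma * beta * e ^+ 2 / (3 * b%:R) -> `|B (x t) - B y| < e.
Proof.
move=> b0 e0 t0; have b0R : 0 < b%:R :> R by rewrite ltr0n.
rewrite ltr_pdivlMr ?mulr_gt0// => rlt.
have le1 := fb_dotB_le hdot hA hB hbeta hgamma hy hdelta (dist_le_b t0).
have le2 : gamma * (beta * `|B (x t) - B y| ^+ 2) <=
    gamma * dot (x t - y) (B (x t) - B y) by rewrite ler_pM2l//; exact: hB.
have : gamma * beta * `|B (x t) - B y| ^+ 2 < gamma * beta * e ^+ 2 by lra.
by rewrite ltr_pM2l ?mulr_gt0// ltr_pXn2r// nnegrE// ltW.
Qed.

(** The strict bound on the residual is what lets [modulus_lt_inv] conclude.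
    When b = 0 the trajectory stays at y, and the rates, which then involve
    divisions by zero, need only be nonnegative. *)
Lemma rates_of_residual_decay (varphi : R -> R) :
  (forall e, 0 <= varphi e) ->
  ((0 < b)%N -> forall e t, 0 < e -> varphi e <= t -> `|r (x t)| < e) ->
  let psi eps := varphi (gamma * beta * eps ^+ 2 / (3 * b%:R)) in
  (uniformly_monotone dot phi A ->
     converges_with_rate x y (fun eps =>
       Num.max
         (varphi (Num.min (gamma * phi (eps / 2) / (2 * b%:R)) (eps / 2)))
         (psi (phi (eps / 2) / (2 * b%:R))))) /\
  (uniformly_monotone dot phi (sv_of B) ->
     converges_with_rate x y (fun eps => psi (phi eps / b%:R))).
Proof.
move=> varphi0 decay psi.
have [b0|b0] := posnP b.
  have xy t e : 0 < e -> 0 <= t -> `|x t - y| <= e.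
    by move=> e0 /dist_le_b /le_trans; apply; rewrite b0 ltW.
  split => _; apply: rate_converges => e e0 t te; apply: xy => //.
    by apply: le_trans te; rewrite le_max varphi0.
  by apply: le_trans te; exact: varphi0.
have b0R : 0 < b%:R :> R by rewrite ltr0n.
have psi_lt t e : 0 < e -> psi e <= t -> `|B (x t) - B y| < e.
  move=> e0 te; apply: forward_dist_lt => //; first exact: le_trans (varphi0 _) te.
  by apply: decay => //; rewrite divr_gt0 ?mulr_gt0 ?exprn_gt0.
split => um; apply: rate_converges => e e0 t.
- have e2 : 0 < e / 2 by rewrite divr_gt0.
  have phi0 := modulus_gt0 e2.
  rewrite ge_max => /andP[t1 t2].
  have t0 : 0 <= t := le_trans (varphi0 _) t1.
  have /decay : 0 < Num.min (gamma * phi (e / 2) / (2 * b%:R)) (e / 2).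
    by rewrite lt_min e2 andbT divr_gt0// mulr_gt0.
  move=> /(_ b0 _ t1); rewrite lt_min => /andP[r1 r2].
  have d1 := psi_lt _ _ (divr_gt0 phi0 (mulr_gt0 (ltr0n R 2) b0R)) t2.
  have := fb_monotoneA_le hdot hA hB hbeta hgamma hy hdelta (dist_le_b t0) um.
  set p := `|fb_map _ _ _ _ - _| => le1.
  have lt1 : gamma * phi p < gamma * phi (e / 2).
    apply: le_lt_trans le1 _.
    move: r1 d1; rewrite !ltr_pdivlMr ?mulr_gt0// => r1.
    rewrite -(ltr_pM2l gamma0) => d1; lra.
  have pe : p < e / 2.
    apply: modulus_lt_inv; [exact: ltW|exact: normr_ge0|].
    by rewrite -(ltr_pM2l gamma0).
  have -> : x t - y = (fb_map A B gamma (x t) - y) - r (x t).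
    by apply: (dot_ext hdot) => w; rewrite /fb_residual !(dotE dot); ring.
  apply: le_trans (ler_normB _ _) _; rewrite -/p; lra.
- move=> te; have phi0 := modulus_gt0 e0.
  have t0 : 0 <= t := le_trans (varphi0 _) te.
  have d1 := psi_lt _ _ (divr_gt0 phi0 b0R) te.
  apply/ltW/modulus_lt_inv => //; first exact: ltW.
  have := um (x t) y (B (x t)) (B y) erefl erefl => /le_lt_trans; apply.
  apply: le_lt_trans (dot_le_norm hdot _ _) _.
  apply: le_lt_trans (ler_wpM2r (normr_ge0 _) (dist_le_b t0)) _.
  by rewrite mulrC -ltr_pdivlMr.
Qed.

(** With K = delta b^2 / e^2 the integral bound reads
    |r x|^2 <= e^2 / delta < e^2. *)
Lemma residual_lt_of_divergence (eta : R -> nat) :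
  lebesgue_measurable_fun `[0, +oo[ lambda ->
  divergence_modulus (fun t => lambda t * (delta - lambda t)) eta ->
  (0 < b)%N -> forall e t, 0 < e ->
  (eta (delta * b%:R ^+ 2 / e ^+ 2))%:R <= t -> `|r (x t)| < e.
Proof.
move=> ml [div _] b0 e t e0 te.
have b0R : 0 < b%:R :> R by rewrite ltr0n.
have d0 : 0 < delta by exact: lt_trans delta1.
set K := delta * _ / _ in te.
have K0 : 0 < K by rewrite /K divr_gt0 ?mulr_gt0 ?exprn_gt0.
have leK := div K t K0 te.
have t0 : 0 <= t := le_trans (ler0n _ _) te.
have mg : lebesgue_measurable_fun `[0, t] (fun s => lambda s * (delta - lambda s)).
  have ml' : measurable_fun (`[0, t]%classic : set (lebesgueR R)) (lambda : lebesgueR R -> R).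
    apply: measurable_funS ml; first exact: measurable_itv_lebesgue.
    by apply: subset_itv; rewrite // bnd_simp.
  exact: measurable_fun_mul_cstB ml'.
(* At t = 0 the integral would vanish, while it is at least K > 0. *)
have tp : 0 < t.
  rewrite lt_def t0 andbT; apply/eqP => t00.
  move: leK mg; rewrite t00 => leK mg.
  have mD := measurable_itv_lebesgue (R := R) `[0, 0].
  have mu0 : @completed_lebesgue_measure R [set` `[(0 : R), 0]] = 0%E.
    by rewrite completed_lebesgue_measure_itvcc// subrr.
  have mg' := proj2 (@measurable_EFinP _ _ _ _ _) mg.
  by move: leK; rewrite (null_set_integral mD mg' mu0) lee_fin leNgt K0.
have := residual_integral_le hdot hA hB hbeta hgamma hy hdelta hlambda hx tp mg _ leK.
move=> /(_ _)/wrap[].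
  move=> s /andP[s0 _]; have /andP[l0 l1] := hlambda s0.
  by rewrite mulr_ge0 ?subr_ge0//= ler_wpM2l// gerBl.
move=> le1.
have : `|r (x t)| ^+ 2 * K <= b%:R ^+ 2.
  by apply: le_trans le1 _; rewrite ler_pXn2r// nnegrE// ltW.
rewrite /K mulrA ler_pdivrMr ?exprn_gt0// => le2.
rewrite -(@ltr_pXn2r _ 2)// ?nnegrE ?(ltW e0)//.
rewrite ltNge; apply/negP => le3.
have c0 : 0 < b%:R ^+ 2 * e ^+ 2 by rewrite mulr_gt0// exprn_gt0.
have le4 : e ^+ 2 * (delta * b%:R ^+ 2) <= `|r (x t)| ^+ 2 * (delta * b%:R ^+ 2).
  by rewrite ler_wpM2r// mulr_ge0 ?sqr_ge0// ltW.
have : b%:R ^+ 2 * e ^+ 2 * 1 < b%:R ^+ 2 * e ^+ 2 * delta by rewrite ltr_pM2l.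
lra.
Qed.

(** The integral bound with the constant g = lam reads lam t |r x|^2 <= b^2,
    and lam < 4 b^2 delta^2 because lam <= delta, 1 < delta and 1 <= b. *)
Lemma residual_lt_of_lower_bound (lam : R) : 0 < lam ->
  (forall t, 0 <= t -> lam <= lambda t) ->
  (0 < b)%N -> forall e t, 0 < e ->
  4 * b%:R ^+ 4 * delta ^+ 2 / (lam ^+ 2 * e ^+ 2) <= t -> `|r (x t)| < e.
Proof.
move=> lam0 lamle b0 e t e0.
have b1 : 1 <= b%:R :> R by rewrite ler1n.
have b0R : 0 < b%:R :> R by rewrite ltr0n.
have d0 : 0 < delta by exact: lt_trans delta1.
have lamd : lam <= delta.
  by apply: le_trans (lamle 0 (lexx _)) _; case/andP: (hlambda (lexx 0)).
set M := 4 * _ * _.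
have M0 : 0 < M by rewrite !mulr_gt0 ?exprn_gt0.
have N0 : 0 < lam ^+ 2 * e ^+ 2 by rewrite mulr_gt0 ?exprn_gt0.
move=> te; have t0 : 0 < t by apply: lt_le_trans te; rewrite divr_gt0.
have := residual_integral_le hdot hA hB hbeta hgamma hy hdelta hlambda hx (g := fun=> lam)
  (K := lam * t) t0 (measurable_cst _).
move=> /(_ _ _)/wrap[].
- move=> s /andP[s0 _]; rewrite (ltW lam0)/=.
  apply: le_trans (lamle s s0) _; rewrite ler_peMr ?(ltW delta1)//.
  by case/andP: (hlambda s0).
- rewrite (@integral_cst _ _ _ _ _ (measurable_itv_lebesgue `[0, t])).
  by rewrite [X in (_ * X)%E](completed_lebesgue_measure_itvcc (ltW t0)) subr0 EFinM.
move=> le1.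
have le2 : `|r (x t)| ^+ 2 * (lam * t) <= b%:R ^+ 2.
  by apply: le_trans le1 _; rewrite ler_pXn2r// nnegrE// ltW.
rewrite -(@ltr_pXn2r _ 2)// ?nnegrE ?(ltW e0)//.
move: te; rewrite ler_pdivrMr// => te.
have le3 : `|r (x t)| ^+ 2 * lam * M <= b%:R ^+ 2 * (lam ^+ 2 * e ^+ 2).
  apply: le_trans (ler_wpM2l _ te) _; first by rewrite mulr_ge0 ?sqr_ge0 ?ltW.
  by have := ler_wpM2r (ltW N0) le2; rewrite !mulrA.
have c0 : 0 < b%:R ^+ 2 * lam by rewrite mulr_gt0 ?exprn_gt0.
have le4 : `|r (x t)| ^+ 2 * (4 * b%:R ^+ 2 * delta ^+ 2) <= lam * e ^+ 2.
  rewrite -(ler_pM2l c0); move: le3; rewrite /M; lra.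
have lt5 : lam < 4 * b%:R ^+ 2 * delta ^+ 2.
  have bb : 1 <= b%:R ^+ 2 :> R by rewrite exprn_ege1.
  have dd : delta <= delta ^+ 2 by rewrite expr2 ler_peMr ?ltW.
  have := ler_wpM2l (ltW d0) bb.
  have := ler_pM (ltW d0) ler01 dd bb.
  lra.
have q0 := lt_trans lam0 lt5.
rewrite -(ltr_pM2r q0); apply: le_lt_trans le4 _.
by rewrite mulrC ltr_pM2l ?exprn_gt0.
Qed.

End rates.

Theorem theorem4p14 (R : realType) (X : completeNormedModType R)
    (dot : {dot X for idfun}) (hdot : norm_of_dot dot)
    (A : X -> set X) (hA : maximally_monotone dot A)
    (B : X -> X) (beta : R) (hbeta : 0 < beta) (hB : cocoercive dot beta B)
    (gamma : R) (hgamma : 0 < gamma < 2 * beta)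
    (delta : R) (hdelta : delta = Num.min 1 (beta / gamma) + 1 / 2)
    (x0 y : X) (hy : zer (sv_add A (sv_of B)) y)
    (b : nat) (hb : `|x0 - y| <= b%:R)
    (lambda : R -> R) (hlambda : forall t : R, 0 <= t -> 0 <= lambda t <= delta)
    (mlambda : lebesgue_measurable_fun `[0, +oo[ lambda)
    (x : R -> X) (hx : strong_global_solution A B gamma lambda x0 x)
    (phi : R -> R) (hphi : monotonicity_modulus phi) :
  let rates (varphi : R -> R) :=
    let psi eps := varphi (gamma * beta * eps ^+ 2 / (3 * b%:R)) in
    (uniformly_monotone dot phi A ->
       converges_with_rate x y (fun eps =>
         Num.max
           (varphi (Num.min (gamma * phi (eps / 2) / (2 * b%:R)) (eps / 2)))
           (psi (phi (eps / 2) / (2 * b%:R))))) /\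
    (uniformly_monotone dot phi (sv_of B) ->
       converges_with_rate x y (fun eps => psi (phi eps / b%:R))) in
  (forall eta : R -> nat,
     (\int[@completed_lebesgue_measure R]_(t in `[0%R, +oo[)
        (lambda t * (delta - lambda t))%:E = +oo)%E ->
     divergence_modulus (fun t => lambda t * (delta - lambda t)) eta ->
     rates (fun eps => (eta (delta * b%:R ^+ 2 / eps ^+ 2))%:R)) /\
  (forall lam : R,
     0 < inf [set lambda t | t in `[0, +oo[] ->
     0 < lam ->
     (forall t : R, 0 <= t -> lam <= lambda t) ->
     rates (fun eps =>
       4 * b%:R ^+ 4 * delta ^+ 2 / (lam ^+ 2 * eps ^+ 2))).
Proof.
move=> rates; split => [eta _ hdiv|lam _ lam0 lamle].
- apply: (rates_of_residual_decay hdot hA hB hbeta hgamma hy hdelta hlambda hx hb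
    hphi) => [e|]; first exact: ler0n.
  exact: (residual_lt_of_divergence hdot hA hB hbeta hgamma hy hdelta hlambda hx hb
    mlambda hdiv).
- apply: (rates_of_residual_decay hdot hA hB hbeta hgamma hy hdelta hlambda hx hb
    hphi) => [e|].
    have b4 : 0 <= b%:R ^+ 4 :> R by rewrite exprn_ge0.
    by rewrite divr_ge0// mulr_ge0 ?sqr_ge0 ?mulr_ge0.
  exact: (residual_lt_of_lower_bound hdot hA hB hbeta hgamma hy hdelta hlambda hx hb
    lam0 lamle).
Qed.
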